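(* Let $A$ be an irreducible $4\times 4$ tridiagonal stochastic matrix. Then $A$ has at most two negative eigenvalues, counted with multiplicity.
   Context: A real matrix is stochastic if its entries are nonnegative and each row sums to $1$. Thus a $4\times4$ tridiagonal stochastic matrix is a matrix $$A=\begin{pmatrix}\alpha & 1-\alpha & 0 & 0\\ \beta & \gamma & 1-\beta-\gamma & 0\\ 0 & \delta & \phi & 1-\delta-\phi\\ 0 & 0 & 1-\kappa & \kappa\end{pmatrix}$$ with $0\le \alpha,\beta,\gamma,\delta,\phi,\kappa\le 1$, $\beta+\gamma\le 1$ and $\delta+\phi\le 1$. Irreducible means irreducible as a nonnegative matrix (its associated directed graph is strongly connected). All eigenvalues of an irreducible tridiagonal stochastic matrix are real. *)

(* Defs.v *)
From mathcomp Require Import all_boot all_order all_algebra.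
From mathcomp Require Import polyrcf.

Set Implicit Arguments.
Unset Strict Implicit.
Unset Printing Implicit Defensive.

Import Order.TTheory GRing.Theory Num.Theory.
Local Open Scope ring_scope.

Definition stochastic (R : rcfType) (n : nat) (A : 'M[R]_n) : Prop :=
  (forall i j, 0 <= A i j) /\ (forall i, \sum_j A i j = 1).

Definition tridiagonal (R : rcfType) (n : nat) (A : 'M[R]_n) : Prop :=
  forall i j : 'I_n, (i.+1 < j)%N || (j.+1 < i)%N -> A i j = 0.

Definition irreducible_mx (R : rcfType) (n : nat) (A : 'M[R]_n) : Prop :=
  forall i j : 'I_n, connect (fun k l : 'I_n => A k l != 0) i j.

(* [rootsR p] lists the roots of [p] in [R] without repetition; [mup x]       *)
(* restores the algebraic multiplicities.                                    *)
Definition num_neg_eigenvalues (R : rcfType) (n : nat) (A : 'M[R]_n) : nat :=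
  (\sum_(x <- rootsR (char_poly A) | (x < 0)%R) mup x (char_poly A))%N.

Lemma uniq_rootsR_char_poly (R : rcfType) (n : nat) (A : 'M[R]_n) :
  uniq (rootsR (char_poly A)).
Proof. exact: uniq_roots. Qed.

Lemma mem_rootsR_char_poly (R : rcfType) (n : nat) (A : 'M[R]_n) (x : R) :
  (x \in rootsR (char_poly A)) = eigenvalue A x.
Proof.
rewrite eigenvalue_root_char.
by rewrite -roots_on_rootsR ?monic_neq0 ?char_poly_monic // in_itv.
Qed.

(* Main.v *)
Require Import Defs.
From mathcomp Require Import all_boot all_order all_algebra.
From mathcomp Require Import polyrcf.
From mathcomp Require Import ring lra.

Import Order.TTheory GRing.Theory Num.Theory.
Local Open Scope ring_scope.

(* If [A] had three negative eigenvalues, its characteristic polynomial,      *)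
(* which has the root 1, would be [(X - 1) q] with [q > 0] on [[0, +oo)], so  *)
(* it would be negative on [[0, 1)]. But it takes a nonnegative value there:  *)
(* if [m <= M] are the roots of the characteristic polynomial of the trailing *)
(* 2x2 block, then [m <= A 3 3 <= M], and the clamping of [A 0 0] to          *)
(* [[m, M]] is such a point.                                                  *)

(** The test point comes from writing the characteristic polynomial as ((x - a)(x - g) - u) T(x) - v
    (x - a)(x - k), where a, g, f, k is the diagonal, u, v, w are the products of opposite
    off-diagonal entries, and T(x) = (x - f)(x - k) - w belongs to the trailing block
    ([tridiagonal4_nonneg_value]). The factorisation is a degree count: three negative roots and the
    root 1 exhaust degree 4. *)

Lemma dvdp_prod_mup (F : fieldType) (p : {poly F}) (s : seq F) :
  p != 0 -> uniq s -> \prod_(x <- s) ('X - x%:P) ^+ mup x p %| p.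
Proof.
move=> p0; elim: s => [|x s IHs] /=; first by rewrite big_nil dvd1p.
case/andP=> xs /IHs ds; rewrite big_cons Gauss_dvdp ?ds ?andbT.
  by rewrite -mup_geq.
rewrite big_seq; apply: (big_ind (coprimep _)) => [||y ys].
- exact: coprimep1.
- by move=> q r cq cr; rewrite coprimepMr cq.
- apply/coprimep_expl/coprimep_expr; rewrite coprimep_XsubC root_XsubC.
  by apply: contraNneq xs => <-.
Qed.

Lemma size_prod_mup (F : fieldType) (p : {poly F}) (s : seq F) :
  size (\prod_(x <- s) ('X - x%:P) ^+ mup x p)
    = (\sum_(x <- s) mup x p)%N.+1.
Proof.
elim: s => [|x s IHs]; first by rewrite !big_nil size_poly1.
rewrite !big_cons size_Mmonic; first by rewrite IHs size_exp_XsubC addnS.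
  by rewrite monic_neq0 // monic_exp // monicXsubC.
by apply: monic_prod => y _; rewrite monic_exp // monicXsubC.
Qed.

Lemma det_tridiagonal4 (R : comNzRingType) (a : nat -> nat -> R) :
    (forall i j, (i.+1 < j)%N || (j.+1 < i)%N -> a i j = 0) ->
  \det (\matrix_(i < 4, j < 4) a i j) =
    a 0%N 0%N * a 1%N 1%N * a 2%N 2%N * a 3%N 3%N
    - a 0%N 1%N * a 1%N 0%N * a 2%N 2%N * a 3%N 3%N
    - a 1%N 2%N * a 2%N 1%N * a 0%N 0%N * a 3%N 3%N
    - a 2%N 3%N * a 3%N 2%N * a 0%N 0%N * a 1%N 1%N
    + a 0%N 1%N * a 1%N 0%N * (a 2%N 3%N * a 3%N 2%N).
Proof.
move=> tri.
do 4! rewrite ?(expand_det_row _ ord0) ?big_ord_recl ?big_ord0 /cofactor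
        ?det_mx11 ?mxE /=.
rewrite /bump /= ?(tri 0%N 2%N) ?(tri 0%N 3%N) ?(tri 1%N 3%N) ?(tri 2%N 0%N)
  ?(tri 3%N 0%N) ?(tri 3%N 1%N) //.
ring.
Qed.

Lemma horner_char_poly (R : comNzRingType) (n : nat) (A : 'M[R]_n) (x : R) :
  (char_poly A).[x] = \det (x%:M - A).
Proof.
rewrite /char_poly -horner_evalE -det_map_mx; congr (\det _).
apply/matrixP=> i j.
by rewrite !mxE /= horner_evalE hornerD hornerN hornerC hornerMn hornerX.
Qed.

Lemma horner_char_poly_tridiagonal4 (R : rcfType) (A : 'M[R]_4) (x : R) :
    tridiagonal A ->
  let a i j := A (inord i) (inord j) in
  (char_poly A).[x] =
    (x - a 0%N 0%N) * (x - a 1%N 1%N) * (x - a 2%N 2%N) * (x - a 3%N 3%N)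
    - a 0%N 1%N * a 1%N 0%N * (x - a 2%N 2%N) * (x - a 3%N 3%N)
    - a 1%N 2%N * a 2%N 1%N * (x - a 0%N 0%N) * (x - a 3%N 3%N)
    - a 2%N 3%N * a 3%N 2%N * (x - a 0%N 0%N) * (x - a 1%N 1%N)
    + a 0%N 1%N * a 1%N 0%N * (a 2%N 3%N * a 3%N 2%N).
Proof.
move=> tri a; rewrite horner_char_poly.
(* [inord] sends out-of-range indices to 0, so [a] need not vanish far from the diagonal; the
   cut-off restores this. *)
pose b i j := if (i < 4)%N && (j < 4)%N then x *+ (i == j) - a i j else 0.
have -> : x%:M - A = \matrix_(i < 4, j < 4) b i j.
  by apply/matrixP=> i j; rewrite !mxE /b /a !ltn_ord !inord_val.
rewrite det_tridiagonal4 /b /=; first by ring.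
move=> i j ij; case: ifP => // /andP[i4 j4].
rewrite /a tri ?inordK // subr0; case: eqP ij => // ->.
by rewrite !ltnNge !leqnSn.
Qed.

(** A path from [i] to [j] must leave [i], and the step leaving it is a positive off-diagonal entry
    in row [i]. *)
Lemma diag_stochastic_lt1 (R : rcfType) (n : nat) (A : 'M[R]_n) (i j : 'I_n) :
  stochastic A -> irreducible_mx A -> i != j -> A i i < 1.
Proof.
move=> [A0 A1] /(_ i j) /connectP[p pth ->] ij.
have [k ki Aik] : exists2 k, k != i & A i k != 0.
  elim: p pth ij => [|k p IHp] /=; first by rewrite eqxx.
  case/andP=> Aik; have [->|ki _ _] := eqVneq k i; first exact: IHp.
  by exists k.
rewrite -(A1 i) (bigD1 i) //= ltrDl (bigD1 k) //=.
by rewrite ltr_pwDl ?lt0r ?Aik ?A0 // sumr_ge0.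
Qed.

(** Here [m] and [M] are the roots of (x - f)(x - k) - w; its value at [k] is -w <= 0, so [k] lies
    between them. *)
Lemma quadratic_eigenvalues (R : rcfType) (f k w : R) : 0 <= w ->
  exists m M, [/\ m <= k, k <= M, f = m + M - k & w = (M - k) * (k - m)].
Proof.
move=> w0; set d := (f - k) ^+ 2 + 4 * w.
have d0 : 0 <= d by rewrite addr_ge0 ?sqr_ge0 ?mulr_ge0.
have fks : `|f - k| <= Num.sqrt d.
  by rewrite -sqrtr_sqr ler_sqrt // lerDl mulr_ge0.
have := sqr_sqrtr d0; move: fks; set s := Num.sqrt d => fks sd.
have [fk1 fk2] : f - k <= s /\ k - f <= s.
  by move: fks; rewrite ler_norml => /andP[]; lra.
exists ((f + k - s) / 2), ((f + k + s) / 2); split; try lra.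
rewrite (_ : w = (s ^+ 2 - (f - k) ^+ 2) / 4); first by field.
by rewrite sd /d; field.
Qed.

Lemma tridiagonal4_nonneg_value (R : rcfType) (a g f k u v w : R) :
    0 <= a < 1 -> 0 <= k < 1 -> 0 <= u -> 0 <= v -> 0 <= w ->
  exists2 x, 0 <= x < 1 &
    0 <= (x - a) * (x - g) * (x - f) * (x - k) - u * (x - f) * (x - k)
         - v * (x - a) * (x - k) - w * (x - a) * (x - g) + u * w.
Proof.
move=> /andP[a0 a1] /andP[k0 k1] u0 v0 w0.
have [m [M [mk kM -> ->]]] := quadratic_eigenvalues _ f k w w0.
(* At [m] and [M] only -v (x - a)(x - k) survives; at [a] only -u (a - m)(a - M). *)
have [am|ma] := ltP a m.
  exists m; first by apply/andP; split; lra.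
  rewrite [leRHS](_ : _ = v * ((m - a) * (k - m))); last by ring.
  by rewrite !mulr_ge0 ?subr_ge0 // ltW.
have [Ma|aM] := ltP M a.
  exists M; first by apply/andP; split; lra.
  rewrite [leRHS](_ : _ = v * ((a - M) * (M - k))); last by ring.
  by rewrite !mulr_ge0 ?subr_ge0 // ltW.
exists a; first by rewrite a0.
rewrite [leRHS](_ : _ = u * ((M - a) * (a - m))); last by ring.
by rewrite !mulr_ge0 ?subr_ge0.
Qed.

Lemma root_char_poly_stochastic (R : rcfType) (n : nat) (A : 'M[R]_n.+1) :
  stochastic A -> root (char_poly A) 1.
Proof.
move=> [_ A1]; rewrite rootE horner_char_poly -det_tr; apply/det0P.
(* Row sums equal to 1 make the all-ones vector fixed by [A]; the transpose turns it into a row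
   vector. *)
exists (const_mx 1).
  by apply/rV0Pn; exists ord0; rewrite mxE oner_neq0.
apply/rowP=> i; rewrite !mxE.
under eq_bigr => j _ do rewrite !mxE mul1r.
by rewrite sumrB A1 (bigD1 i) //= eqxx big1 ?addr0 ?subrr // => j /negPf ji;
  rewrite eq_sym ji.
Qed.

Theorem theorem2p7 (R : rcfType) (A : 'M[R]_4)
    (hstoch : stochastic A) (htri : tridiagonal A) (hirr : irreducible_mx A) :
  (num_neg_eigenvalues A <= 2)%N.
Proof.
set p := char_poly A; have p_monic : p \is monic := char_poly_monic A.
have p0 : p != 0 := monic_neq0 p_monic.
have [A0 _] := hstoch.
have diag i : 0 <= A i i < 1.
  (* Any index other than [i] serves; [i + 1] is taken cyclically. *)
  rewrite A0 (@diag_stochastic_lt1 _ _ A i (i + 1)) //.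
  by rewrite -subr_eq0 opprD addNKr oppr_eq0.
have [x /andP[x0 x1]] := @tridiagonal4_nonneg_value R
  (A (inord 0) (inord 0)) (A (inord 1) (inord 1))
  (A (inord 2) (inord 2)) (A (inord 3) (inord 3)) _ _ _ (diag _) (diag _)
  (mulr_ge0 (A0 (inord 0) (inord 1)) (A0 (inord 1) (inord 0)))
  (mulr_ge0 (A0 (inord 1) (inord 2)) (A0 (inord 2) (inord 1)))
  (mulr_ge0 (A0 (inord 2) (inord 3)) (A0 (inord 3) (inord 2))).
rewrite -horner_char_poly_tridiagonal4 // -/p => px_ge0.
rewrite leqNgt; apply/negP; rewrite /num_neg_eigenvalues -/p -big_filter.
set s := filter _ _ => s_gt2.
pose q := \prod_(y <- s) ('X - y%:P) ^+ mup y p.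
have q_gt0 y : 0 <= y -> 0 < q.[y].
  move=> y0; rewrite /q horner_prod big_seq prodr_gt0 // => z.
  rewrite mem_filter => /andP[z0 _].
  by rewrite horner_exp hornerXsubC exprn_gt0 // subr_gt0 (lt_le_trans z0).
have q1p : q * ('X - 1%:P) %| p.
  rewrite Gauss_dvdp.
    rewrite dvdp_prod_mup ?filter_uniq ?uniq_rootsR_char_poly //=.
    by rewrite -root_factor_theorem root_char_poly_stochastic.
  by rewrite coprimep_XsubC rootE gt_eqF // q_gt0.
have q_monic : q \is monic.
  by apply: monic_prod => y _; rewrite monic_exp // monicXsubC.
have pE : p = q * ('X - 1%:P).
  apply/esym/eqP; rewrite -eqp_monic ?monicMl ?monicXsubC //.
  (* The size of [p] is 5, and that of the divisor is the number of negative roots, with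
     multiplicity, plus 2. *)
  rewrite -dvdp_size_eqp // eqn_leq dvdp_leq //=.
  by rewrite size_Mmonic ?monicXsubC ?monic_neq0 // size_XsubC addn2 /=
    size_prod_mup size_char_poly.
move: px_ge0; rewrite leNgt pE hornerM hornerXsubC.
by rewrite nmulr_llt0 ?subr_lt0 ?q_gt0.
Qed.
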